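(* The following decision problem is in $\mathsf{AC}^0$. Input: transformations $a_1,\dots,a_k\in T_n$. Problem: is the transformation semigroup $\langle a_1,\dots,a_k\rangle$ a semilattice?
   Context: $T_n$ is the full transformation semigroup on $[n]=\{1,\dots,n\}$: all maps $[n]\to[n]$, acting on the right, under composition. $\langle a_1,\dots,a_k\rangle$ is the subsemigroup of $T_n$ generated by $a_1,\dots,a_k$ ($k,n\ge 1$). In the input each transformation is given by its table of values, and $k,n$ are part of the input. A semilattice is a semigroup $S$ that is commutative ($st=ts$ for all $s,t\in S$) and idempotent ($s^2=s$ for all $s\in S$). $\mathsf{AC}^0$ is the class of all sets decidable by (polynomial-size) unbounded fan-in Boolean circuits of constant depth. *)

(* Defs.v *)
From HB Require Import structures.
From mathcomp Require Import all_boot.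

Set Implicit Arguments.
Unset Strict Implicit.
Unset Printing Implicit Defensive.

(* The point i of {1, ..., n} is the ordinal of value i - 1. The alias shields *)
(* the composition product from the library's pointwise product on finfuns.   *)
Definition transf (n : nat) := {ffun 'I_n -> 'I_n}.

HB.instance Definition _ n := Finite.on (transf n).

(* Maps act on the right: x (f g) = (x f) g. *)
Definition transf_mul n (f g : transf n) : transf n := [ffun x => g (f x)].

Lemma transf_mulA n : associative (@transf_mul n).
Proof. by move=> f g h; apply/ffunP=> x; rewrite !ffunE. Qed.

HB.instance Definition _ n := isSemigroup.Build (transf n) (@transf_mulA n).

Section Semigroups.

Local Open Scope group_scope.

Variable G : semigroupType.

Inductive subsemigroup_gen (A : {pred G}) : G -> Prop :=
| Subsemigroup_gen_in a : a \in A -> subsemigroup_gen A a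
| Subsemigroup_gen_mul s t :
    subsemigroup_gen A s -> subsemigroup_gen A t ->
    subsemigroup_gen A (s * t).

Definition is_semilattice (S : G -> Prop) : Prop :=
  [/\ forall s t, S s -> S t -> S (s * t),
      forall s t, S s -> S t -> s * t = t * s
    & forall s, S s -> s * s = s].

End Semigroups.

(* In a circuit with m inputs, node i is the i-th input for i < m and node    *)
(* m + j is the j-th gate. A gate may only read nodes of smaller index; its   *)
(* fan-in and the fan-out of nodes are unbounded. Constants are And [::] and  *)
(* Or [::].                                                                   *)
Inductive gate :=
| Not of nat
| And of seq nat
| Or of seq nat.

Definition gate_args (g : gate) : seq nat :=
  match g with Not i => [:: i] | And s => s | Or s => s end.

Record circuit := Circuit { gates : seq gate; output : nat }.

Definition circuit_size (C : circuit) : nat := size (gates C).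

Fixpoint wf_gates (m : nat) (gs : seq gate) : bool :=
  if gs is g :: gs' then
    all (fun i => i < m) (gate_args g) && wf_gates m.+1 gs'
  else true.

Definition wf_circuit (m : nat) (C : circuit) : bool :=
  wf_gates m (gates C) && (output C < m + circuit_size C).

Definition gate_value (vs : seq bool) (g : gate) : bool :=
  match g with
  | Not i => ~~ nth false vs i
  | And s => all (nth false vs) s
  | Or s => has (nth false vs) s
  end.

Definition node_values (C : circuit) (x : seq bool) : seq bool :=
  foldl (fun vs g => rcons vs (gate_value vs g)) x (gates C).

Definition circuit_accepts (C : circuit) (x : seq bool) : bool :=
  nth false (node_values C x) (output C).

Definition gate_depth (ds : seq nat) (g : gate) : nat :=
  (\max_(i <- gate_args g) nth 0 ds i).+1.

Definition node_depths (m : nat) (C : circuit) : seq nat :=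
  foldl (fun ds g => rcons ds (gate_depth ds g)) (nseq m 0) (gates C).

Definition circuit_depth (m : nat) (C : circuit) : nat :=
  nth 0 (node_depths m C) (output C).

(* One circuit for each input length; no uniformity is imposed. *)
Definition AC0 (L : seq bool -> Prop) : Prop :=
  exists (C : nat -> circuit) (d e : nat), forall m : nat,
    [/\ wf_circuit m (C m),
        circuit_size (C m) <= m ^ e + e,
        circuit_depth m (C m) <= d
      & forall x : m.-tuple bool, circuit_accepts (C m) x <-> L x].

(* Least significant bit first. *)
Definition bits (w v : nat) : seq bool := mkseq (fun j => odd (v %/ 2 ^ j)) w.

(* The number of binary digits of n, for n > 0. *)
Definition bit_length (n : nat) : nat := (trunc_log 2 n).+1.

Definition encode_table n (f : transf n) : seq bool :=
  flatten [seq bits (bit_length n) (f x).+1 | x <- enum 'I_n].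

(* The word 1^n 0 1^k 0 followed by the k tables, where every value in        *)
(* {1, ..., n} is written in binary with the same number of digits.           *)
Definition encode n k (a : k.-tuple (transf n)) : seq bool :=
  nseq n true ++ false :: nseq k true ++ false ::
    flatten [seq encode_table f | f <- a].

Definition semilattice_problem (w : seq bool) : Prop :=
  exists (n k : nat) (a : k.-tuple (transf n)),
    [/\ 0 < n, 0 < k, w = encode a
      & is_semilattice (subsemigroup_gen [in a])].

(* Main.v *)
(* Commuting idempotents generate a semilattice, so only the generators matter:
   for all i, j the equations a_i a_i = a_i and a_i a_j = a_j a_i must hold.
   Once n and k are fixed, "a_i sends x to y" is a conjunction of input literals
   at known positions, so these equations, as well as the validity of the
   encoding, are first-order over the atoms [a_i x = y] with quantifiers ranging
   over sets of size at most m; the circuit is the disjunction over the pairs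
   (n, k) compatible with the input length m. *)
Require Import Defs.
From mathcomp Require Import all_boot zify.

Set Implicit Arguments.
Unset Strict Implicit.
Unset Printing Implicit Defensive.

(** * Semilattices and their generators *)

Section SemilatticeGenerators.

Local Open Scope group_scope.

Variables (G : semigroupType) (A : {pred G}).

(** Two inductions: a generator commutes with every product of generators, and hence so does each
    such product. *)
Lemma subsemigroup_gen_commute :
  {in A &, forall a b : G, a * b = b * a} ->
  forall s t, subsemigroup_gen A s -> subsemigroup_gen A t -> s * t = t * s.
Proof.
move=> cA; have cAg a t : a \in A -> subsemigroup_gen A t -> a * t = t * a.
  move=> Aa; elim=> [b Ab|u v _ IHu _ IHv]; first exact: cA.
  by rewrite mulgA IHu -mulgA IHv mulgA.
move=> s t; elim=> [a Aa|u v _ IHu _ IHv] gt; first exact: cAg.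
by rewrite -mulgA IHv // mulgA IHu // mulgA.
Qed.

(** Once commutation is extended to products, idempotence follows by induction: (uv)(uv) = u(vu)v =
    u(uv)v = (uu)(vv) = uv. *)
Lemma is_semilattice_genP :
  is_semilattice (subsemigroup_gen A) <->
  {in A, forall a : G, a * a = a} /\ {in A &, forall a b : G, a * b = b * a}.
Proof.
split=> [[_ cS iS]|[iA cA]].
  split=> [a Aa|a b Aa Ab]; first by apply/iS/Subsemigroup_gen_in.
  by apply: cS; apply: Subsemigroup_gen_in.
have cS := subsemigroup_gen_commute cA; split=> //.
  by move=> s t; apply: Subsemigroup_gen_mul.
move=> s; elim=> [a /iA //|u v gu uu gv vv].
by rewrite -mulgA [v * _]mulgA (cS v u) // -mulgA vv mulgA uu.
Qed.

End SemilatticeGenerators.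

(** * Evaluation of growing gate lists *)

Section FoldRcons.

Variables (T S : Type) (f : seq T -> S -> T) (x0 : T).

Let run := foldl (fun vs g => rcons vs (f vs g)).

Lemma size_foldl_rcons vs gs : size (run vs gs) = size vs + size gs.
Proof.
by elim: gs vs => [|g gs IH] vs /=; rewrite ?addn0 // IH size_rcons addnS.
Qed.

(** Each step only appends on the right. Hence a node keeps its value and its depth when further
    gates follow. *)
Lemma nth_foldl_rcons vs gs i :
  i < size vs -> nth x0 (run vs gs) i = nth x0 vs i.
Proof.
elim: gs vs => //= g gs IH vs ltiv.
by rewrite IH ?nth_rcons ?ltiv // size_rcons ltnW.
Qed.

End FoldRcons.

(** This is [node_values] with the bare gate list as argument, so that the list can be extended;
    [depths] does the same for [node_depths]. *)
Definition values (gs : seq gate) (x : seq bool) : seq bool :=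
  foldl (fun vs g => rcons vs (gate_value vs g)) x gs.

Definition depths (m : nat) (gs : seq gate) : seq nat :=
  foldl (fun ds g => rcons ds (gate_depth ds g)) (nseq m 0) gs.

Lemma size_values gs x : size (values gs x) = size x + size gs.
Proof. exact: size_foldl_rcons. Qed.

Lemma size_depths m gs : size (depths m gs) = m + size gs.
Proof. by rewrite size_foldl_rcons size_nseq. Qed.

Lemma nth_values_cat gs gs' x i : i < size x + size gs ->
  nth false (values (gs ++ gs') x) i = nth false (values gs x) i.
Proof.
by move=> lti; rewrite /values foldl_cat nth_foldl_rcons ?size_foldl_rcons.
Qed.

Lemma nth_depths_cat m gs gs' i : i < m + size gs ->
  nth 0 (depths m (gs ++ gs')) i = nth 0 (depths m gs) i.
Proof.
move=> lti; rewrite /depths foldl_cat nth_foldl_rcons //.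
by rewrite size_foldl_rcons size_nseq.
Qed.

Lemma values_rcons gs g x :
  values (rcons gs g) x = rcons (values gs x) (gate_value (values gs x) g).
Proof. by rewrite /values foldl_rcons. Qed.

Lemma depths_rcons m gs g :
  depths m (rcons gs g) = rcons (depths m gs) (gate_depth (depths m gs) g).
Proof. by rewrite /depths foldl_rcons. Qed.

Lemma wf_gates_rcons m gs g :
  wf_gates m (rcons gs g) =
  wf_gates m gs && all (fun i => i < m + size gs) (gate_args g).
Proof.
elim: gs m => [|h gs IH] m /=; first by rewrite addn0 andbT.
by rewrite IH addnS andbA.
Qed.

(* Quantifying over the gates gs that are already present lets circuits be put
   side by side without renumbering nodes. The existentials are informative so
   that a circuit for each input length is obtained without a choice axiom. *)
Definition realizes (m d s : nat) (P : seq bool -> bool) : Type :=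
  forall gs, wf_gates m gs ->
  {gs' & {o | [/\ wf_gates m (gs ++ gs'), size gs' <= s,
     o < m + size (gs ++ gs'), nth 0 (depths m (gs ++ gs')) o <= d
   & forall x, size x = m -> nth false (values (gs ++ gs') x) o = P x]}}.

(** * Combining circuits *)

Section Realizes.

Variable m : nat.

Lemma realizes_ext d s P Q :
  (forall x, P x = Q x) -> realizes m d s P -> realizes m d s Q.
Proof.
move=> eqPQ rP gs /rP [gs' [o [wf ss lto od vo]]].
by exists gs', o; split=> // x /vo ->.
Qed.

Lemma realizes_le d d' s s' P :
  d <= d' -> s <= s' -> realizes m d s P -> realizes m d' s' P.
Proof.
move=> led les rP gs /rP [gs' [o [wf ss lto od vo]]].
exists gs', o; split=> //; [exact: leq_trans les | exact: leq_trans led].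
Qed.

Lemma realizes_input i :
  i < m -> realizes m 0 0 (fun x => nth false x i).
Proof.
move=> ltim gs wf; exists [::], i; rewrite cats0; split=> //.
- exact: ltn_addr.
- rewrite /depths nth_foldl_rcons ?size_nseq // nth_nseq.
  by case: ifP.
- by move=> x sx; rewrite /values nth_foldl_rcons ?sx.
Qed.

(** The circuits are built one after another, each after the gates of the previous ones, so sizes
    add up while the depth bound is shared. Earlier output nodes survive by [nth_values_cat] and
    [nth_depths_cat]. *)
Lemma realizes_seq (T : Type) (ts : seq T) (P : T -> seq bool -> bool) d s :
  (forall t, realizes m d s (P t)) ->
  forall gs, wf_gates m gs ->
  {gs' & {os | [/\ wf_gates m (gs ++ gs'), size gs' <= size ts * s,
     all (fun o => o < m + size (gs ++ gs')) os,
     all (fun o => nth 0 (depths m (gs ++ gs')) o <= d) os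
   & forall x, size x = m ->
       map (nth false (values (gs ++ gs') x)) os = map (P^~ x) ts]}}.
Proof.
move=> rP; elim: ts => [|t ts IH] gs wf.
  by exists [::], [::]; rewrite cats0; split.
have [gs1 [o [wf1 ss1 lto1 od1 vo1]]] := rP t gs wf.
have [gs2 [os [wf2 ss2 lto2 od2 vo2]]] := IH _ wf1.
exists (gs1 ++ gs2), (o :: os); rewrite catA; split=> //.
- by rewrite size_cat mulSn leq_add.
- rewrite /= lto2 andbT; apply: leq_trans lto1 _.
  by rewrite leq_add2l [size (_ ++ gs2)]size_cat leq_addr.
- by rewrite /= od2 andbT nth_depths_cat.
- move=> x sx; rewrite /= vo2 // nth_values_cat ?sx //.
  by rewrite vo1.
Qed.

(** One gate on top of a family of circuits costs one level. The parameter [g] builds the gate from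
    its argument list; fixing the length of that list admits [Not]. *)
Lemma realizes_gate (g : seq nat -> gate) (F : seq bool -> bool)
    (T : Type) (ts : seq T) (P : T -> seq bool -> bool) d s :
  (forall os, size os = size ts -> gate_args (g os) = os) ->
  (forall vs os, size os = size ts ->
     gate_value vs (g os) = F (map (nth false vs) os)) ->
  (forall t, realizes m d s (P t)) ->
  realizes m d.+1 (size ts * s).+1 (fun x => F (map (P^~ x) ts)).
Proof.
move=> gargs gval rP gs wf.
have [gs' [os [wf' ss lto od vo]]] := realizes_seq ts rP wf.
have sos: size os = size ts.
  (* Comparing lengths takes some input of length [m]; the all-false word serves. *)
  by have := congr1 size (vo (nseq m false) (size_nseq _ _)); rewrite !size_map.
exists (rcons gs' (g os)), (m + size (gs ++ gs')).
rewrite -rcons_cat wf_gates_rcons wf' gargs // lto; split=> //.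
- by rewrite size_rcons.
- by rewrite size_rcons addnS.
- rewrite depths_rcons nth_rcons size_depths ltnn eqxx /gate_depth gargs //.
  rewrite ltnS; apply/bigmax_leqP_seq => i i_os _.
  exact: (allP od).
- move=> x sx; rewrite values_rcons nth_rcons size_values sx ltnn eqxx.
  by rewrite gval // vo.
Qed.

Lemma realizes_all (T : Type) (ts : seq T) (P : T -> seq bool -> bool) d s :
  (forall t, realizes m d s (P t)) ->
  realizes m d.+1 (size ts * s).+1 (fun x => all (P^~ x) ts).
Proof.
move=> rP; apply: (@realizes_ext _ _ (fun x => all id (map (P^~ x) ts))).
  by move=> x; rewrite all_map.
by apply: (@realizes_gate And (all id)) rP => // vs os _; rewrite /= all_map.
Qed.

Lemma realizes_has (T : Type) (ts : seq T) (P : T -> seq bool -> bool) d s :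
  (forall t, realizes m d s (P t)) ->
  realizes m d.+1 (size ts * s).+1 (fun x => has (P^~ x) ts).
Proof.
move=> rP; apply: (@realizes_ext _ _ (fun x => has id (map (P^~ x) ts))).
  by move=> x; rewrite has_map.
by apply: (@realizes_gate Or (has id)) rP => // vs os _; rewrite /= has_map.
Qed.

Lemma realizes_not P d s :
  realizes m d s P -> realizes m d.+1 s.+1 (fun x => ~~ P x).
Proof.
(* Negation is a gate over a family indexed by [unit]; on lists of length one the defaults of [head]
   are never reached. *)
move=> rP; rewrite -[s]mul1n.
apply: (@realizes_gate (fun os => Not (head 0 os)) (fun bs => ~~ head false bs)
  unit [:: tt] (fun=> P)) => // [[|o [|]]//|vs [|o [|]]//].
Qed.

(** * Connectives and bounded quantifiers at polynomial size *)

Definition poly_realizes d e P := realizes m d ((m + 2) ^ e) P.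

Lemma poly_realizes_le d d' e e' P :
  d <= d' -> e <= e' -> poly_realizes d e P -> poly_realizes d' e' P.
Proof. by move=> led lee; apply: realizes_le; rewrite // leq_pexp2l ?addn2. Qed.

(** This is the cost of one gate over c subcircuits. With B = m + 2 >= 2, it is at most B^(e+1) + 1
    <= B^(e+2); the base stays above 1 even for m = 0. *)
Lemma poly_size_family e c : c <= m + 2 ->
  (c * (m + 2) ^ e).+1 <= (m + 2) ^ e.+2.
Proof.
move=> lec; have lt0: 0 < (m + 2) ^ e.+1 by rewrite expn_gt0 addn2.
apply: (@leq_trans ((m + 2) ^ e.+1).+1).
  by rewrite ltnS expnS leq_mul2r lec orbT.
by rewrite [X in _ <= X]expnS; nia.
Qed.

Lemma poly_realizes_const b : poly_realizes 1 0 (fun=> b).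
Proof.
case: b.
  exact: (@realizes_all void [::] (fun _ _ => true) 0 0).
exact: (@realizes_has void [::] (fun _ _ => true) 0 0).
Qed.

(** A position past the input reads the default [false], so there the literal is a constant. *)
Lemma poly_realizes_literal i b :
  poly_realizes 1 0 (fun x => nth false x i == b).
Proof.
case: (ltnP i m) => [ltim | leim].
  case: b.
    apply: realizes_ext (realizes_le _ _ (realizes_input ltim)) => //.
  apply: realizes_ext (realizes_not (realizes_input ltim)) => x.
  by rewrite eqbF_neg.
move=> gs /(poly_realizes_const (false == b)) [gs' [o [wf ss lto od vo]]].
by exists gs', o; split=> // x sx; rewrite vo // nth_default ?sx.
Qed.

Lemma poly_realizes_not d e P :
  poly_realizes d e P -> poly_realizes d.+1 e.+2 (fun x => ~~ P x).
Proof.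
move=> rP; apply: realizes_le (realizes_not rP) => //.
by rewrite -[X in X.+1]mul1n poly_size_family ?addn2.
Qed.

Lemma poly_realizes_forall q (P : 'I_q -> seq bool -> bool) d e :
  q <= m + 2 -> (forall i, poly_realizes d e (P i)) ->
  poly_realizes d.+1 e.+2 (fun x => [forall i, P i x]).
Proof.
move=> leq rP; apply: (@realizes_ext _ _ (fun x => all (P^~ x) (enum 'I_q))).
  move=> x; apply/allP/forallP => [aP i|aP i _] //.
  by apply: aP; rewrite mem_enum.
apply: realizes_le (realizes_all (enum 'I_q) rP) => //.
by rewrite size_enum_ord poly_size_family.
Qed.

Lemma poly_realizes_exists q (P : 'I_q -> seq bool -> bool) d e :
  q <= m + 2 -> (forall i, poly_realizes d e (P i)) ->
  poly_realizes d.+1 e.+2 (fun x => [exists i, P i x]).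
Proof.
move=> leq rP; apply: (@realizes_ext _ _ (fun x => has (P^~ x) (enum 'I_q))).
  move=> x; apply/hasP/existsP => [[i _ Pi]|[i Pi]]; exists i => //.
  by rewrite mem_enum.
apply: realizes_le (realizes_has (enum 'I_q) rP) => //.
by rewrite size_enum_ord poly_size_family.
Qed.

Lemma poly_realizes_and d1 d2 e1 e2 P Q :
  poly_realizes d1 e1 P -> poly_realizes d2 e2 Q ->
  poly_realizes (maxn d1 d2).+1 (maxn e1 e2).+2 (fun x => P x && Q x).
Proof.
move=> rP rQ; pose R (b : bool) := if b then P else Q.
have rR b : poly_realizes (maxn d1 d2) (maxn e1 e2) (R b).
  case: b; [apply: poly_realizes_le rP | apply: poly_realizes_le rQ];
    by rewrite ?leq_maxl ?leq_maxr.
apply: realizes_ext (realizes_le _ _ (realizes_all [:: true; false] rR)) => //.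
  by move=> x /=; rewrite andbT.
by rewrite poly_size_family ?addn2.
Qed.

(** The condition [b] is settled when the circuit is built, so no gate evaluates it. If it fails,
    the circuit is a constant of depth 1, whence [d.+1]. *)
Lemma poly_realizes_guard (b : bool) d e P :
  (b -> poly_realizes d e P) -> poly_realizes d.+1 e (fun x => b && P x).
Proof.
case: b => rP; first exact: poly_realizes_le (rP isT).
exact: poly_realizes_le (poly_realizes_const false).
Qed.

End Realizes.

(** * From polynomial bounds to [AC0] *)

Lemma shifted_expn_bound c q : exists e, forall m, (m + c) ^ q <= m ^ e + e.
Proof.
(* The summand (1 + c)^q covers the inputs 0 and 1; from 2 on, m + c <= m^(c+1). *)
exists ((c + 1) * q + (1 + c) ^ q) => -[|[|m]].
- apply: leq_trans (leq_addl _ _); apply: leq_trans (leq_addl _ _).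
  by case: q => // q; rewrite leq_exp2r // add1n leqnSn.
- by apply: leq_trans (leq_addl _ _); apply: leq_addl.
apply: leq_trans (leq_addr _ _).
apply: (@leq_trans (m.+2 ^ ((c + 1) * q))); last by rewrite leq_pexp2l // leq_addr.
rewrite expnM; case: q => // q; rewrite leq_exp2r //.
elim: c => [|c IH]; first by rewrite addn0 expn1.
by rewrite addSn expnS; move: (_ ^ _) IH => X; nia.
Qed.

Lemma poly_realizes_AC0 (d e : nat) (P : nat -> seq bool -> bool)
    (L : seq bool -> Prop) :
  (forall m, poly_realizes m d e (P m)) ->
  (forall x, P (size x) x <-> L x) -> AC0 L.
Proof.
move=> rP PL; have [e' le_e'] := shifted_expn_bound 2 e.
(* Extending the empty gate list yields a self-contained circuit. *)
exists (fun m => let: existT gs (exist o _) := rP m [::] isT in Circuit gs o).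
exists d, e' => m; case: (rP m _ _) => gs [o [/= wf ss lto od vo]].
split=> //.
- by rewrite /wf_circuit wf.
- exact: leq_trans ss (le_e' m).
- move=> x; rewrite -PL size_tuple -vo ?size_tuple //.
Qed.

(** * Binary digits and blocks of equal length *)

Lemma nth_bits w v j : j < w -> nth false (bits w v) j = odd (v %/ 2 ^ j).
Proof. by move=> ltj; rewrite nth_mkseq. Qed.

(** Induction on the number of digits: digit 0 is the parity, and the others are the digits of the
    half. *)
Lemma eq_from_bits w u v : u < 2 ^ w -> v < 2 ^ w ->
  (forall j, j < w -> odd (u %/ 2 ^ j) = odd (v %/ 2 ^ j)) -> u = v.
Proof.
elim: w u v => [|w IH] u v; first by rewrite !ltnS !leqn0 => /eqP-> /eqP->.
rewrite expnS => ltu ltv eq_uv.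
have eq0: odd u = odd v by have := eq_uv 0 isT; rewrite !divn1.
rewrite -[u]odd_double_half -[v]odd_double_half eq0; congr (_ + _.*2).
apply: IH => [||j ltj]; try by rewrite -divn2 ltn_divLR // mulnC.
by rewrite -!divn2 -!divnMA -expnS eq_uv.
Qed.

Lemma nth_flatten_uniform (T : Type) (x0 : T) q (ss : seq (seq T)) i r :
  all (fun s => size s == q) ss -> r < q -> i < size ss ->
  nth x0 (flatten ss) (i * q + r) = nth x0 (nth [::] ss i) r.
Proof.
move=> ssq ltr; elim: ss i ssq => // s ss IH [|i] /= /andP[/eqP ss_q ssq] lti.
  by rewrite nth_cat ss_q mul0n ltr.
rewrite nth_cat ss_q mulSn -addnA ltnNge leq_addr /= addKn.
exact: IH.
Qed.

Lemma size_flatten_uniform (T : Type) q (ss : seq (seq T)) :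
  all (fun s => size s == q) ss -> size (flatten ss) = size ss * q.
Proof.
elim: ss => //= s ss IH /andP[/eqP ss_q ssq].
by rewrite size_cat ss_q IH // mulSn.
Qed.

(** * Recognizing the encodings with fixed [n] and [k] *)

Section Encoding.

Variables n k : nat.

Local Notation L := (bit_length n).
Local Notation code := (encode (n := n) (k := k)).

Implicit Types (a : k.-tuple (transf n)) (w : seq bool) (i : 'I_k) (x y : 'I_n).

Lemma encode_table_uniform (f : transf n) :
  all (fun s : seq bool => size s == L) [seq bits L (f x).+1 | x <- enum 'I_n].
Proof. by apply/allP=> s /mapP[x _ ->]; rewrite size_mkseq. Qed.

Lemma size_encode_table (f : transf n) : size (encode_table f) = n * L.
Proof.
by rewrite (size_flatten_uniform (encode_table_uniform f)) size_map size_enum_ord.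
Qed.

Lemma encode_tables_uniform a :
  all (fun s : seq bool => size s == n * L) [seq encode_table f | f <- a].
Proof. by apply/allP=> s /mapP[f _ ->]; rewrite size_encode_table. Qed.

Lemma size_encode a : size (code a) = (n + k).+2 + k * n * L.
Proof.
rewrite size_cat /= size_cat /= !size_nseq.
rewrite (size_flatten_uniform (encode_tables_uniform a)) size_map size_tuple.
by rewrite -mulnA; lia.
Qed.

Lemma nth_encode_header a p : p < (n + k).+2 ->
  nth false (code a) p = (p != n) && (p != (n + k).+1).
Proof.
move=> ltp; rewrite /encode nth_cat size_nseq nth_nseq.
case: (ltngtP p n) => [ltpn|ltnp|->] /=; last by rewrite subnn.
  by rewrite ltn_eqF // ltnS ltnW // ltn_addr.
have -> : p - n = (p - n.+1).+1 by lia.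
rewrite /= nth_cat size_nseq nth_nseq.
case: ltnP => [lt_k|ge_k]; first by apply/esym/eqP; lia.
have -> : p = (n + k).+1 by lia.
by rewrite eqxx (_ : _ - k = 0) //; lia.
Qed.

(** After the header of n + k + 2 letters, the values come table by table, with [L] digits each. *)
Definition entry_pos (i x j : nat) : nat := (n + k).+2 + ((i * n + x) * L + j).

Lemma nth_encode_entry a i x j : j < L ->
  nth false (code a) (entry_pos i x j) = odd ((tnth a i x).+1 %/ 2 ^ j).
Proof.
move=> ltj; rewrite /encode /entry_pos nth_cat size_nseq ltnNge.
rewrite (_ : n <= _) /=; last by lia.
have -> : (n + k).+2 + ((i * n + x) * L + j) - n
  = (k + (1 + ((i * n + x) * L + j))).+1 by lia.
rewrite /= nth_cat size_nseq ltnNge leq_addr /= addKn /=.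
have ltxj : x * L + j < n * L by have := ltn_ord x; nia.
(* First the table, a block of length n L, is located, and then the value inside it, a block of
   length [L]. *)
have -> : (i * n + x) * L + j = i * (n * L) + (x * L + j) by lia.
rewrite nth_flatten_uniform ?encode_tables_uniform ?size_map ?size_tuple //.
rewrite (nth_map [ffun x => x]) ?size_tuple // -tnth_nth.
rewrite nth_flatten_uniform ?encode_table_uniform ?size_map -?enumT ?size_enum_ord //.
by rewrite (nth_map x) ?size_enum_ord // nth_ord_enum nth_bits.
Qed.

(** This is the atom [a_i x = y], meaningful on any word; [y.+1] appears because the points are
    stored as 1, ..., n. *)
Definition has_entry i x y w : bool :=
  [forall j : 'I_L, nth false w (entry_pos i x j) == odd (y.+1 %/ 2 ^ j)].

(** The two exceptional positions are the zeros that end the unary blocks. *)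
Definition has_header w : bool :=
  [forall p : 'I_(n + k).+2,
    nth false w p == (nat_of_ord p != n) && (nat_of_ord p != (n + k).+1)].

(** This rejects blocks that spell 0 or a number above n. *)
Definition has_entries w : bool :=
  [forall i, [forall x, [exists y, has_entry i x y w]]].

Lemma has_entry_encode a i x y : has_entry i x y (code a) = (tnth a i x == y).
Proof.
apply/forallP/eqP => [ent|<- j]; last by rewrite nth_encode_entry.
(* Stored values are at most n < 2^L, so [L] digits determine them. *)
have small (z : 'I_n) : z.+1 < 2 ^ L.
  by apply: leq_ltn_trans (ltn_ord z) (trunc_log_ltn _ _).
apply/val_inj/eq_add_S/(eq_from_bits (small _) (small _)) => j ltj.
by have /eqP := ent (Ordinal ltj); rewrite nth_encode_entry.
Qed.

Lemma encodeP w : size w = (n + k).+2 + k * n * L ->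
  reflect (exists a, w = code a) (has_header w && has_entries w).
Proof.
move=> sw; apply: (iffP andP) => [[/forallP hw /forallP ew]|[a ->]]; last first.
  split; first by apply/forallP=> p; rewrite nth_encode_header.
  apply/forallP=> i; apply/forallP=> x; apply/existsP; exists (tnth a i x).
  by rewrite has_entry_encode.
have ex i x : exists y, has_entry i x y w.
  exact/existsP/(forallP (ew i)).
(* The tables are read off the word, block by block. *)
pose a : k.-tuple (transf n) := [tuple [ffun x => xchoose (ex i x)] | i < k].
exists a; apply: (@eq_from_nth _ false); first by rewrite size_encode.
move=> p ltp; case: (ltnP p (n + k).+2) => [lth|geh].
  by rewrite nth_encode_header //; apply/eqP/(hw (Ordinal lth)).
have [q def_p] : {q | p = (n + k).+2 + q}.
  by exists (p - (n + k).+2); rewrite subnKC.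
have ltq : q < k * n * L by rewrite sw def_p ltn_add2l in ltp.
have ltj : q %% L < L by rewrite ltn_mod.
have ltkn : q %/ L < k * n by rewrite ltn_divLR.
have n_gt0 : 0 < n by case: (n) ltkn; rewrite ?muln0.
have ltx : (q %/ L) %% n < n by rewrite ltn_mod.
have lti : (q %/ L) %/ n < k by rewrite ltn_divLR.
(* Dividing the offset q by [L], and then the quotient by n, recovers digit, point and table. *)
have -> : p = entry_pos (Ordinal lti) (Ordinal ltx) (q %% L).
  by rewrite /entry_pos /= -!divn_eq.
rewrite nth_encode_entry // tnth_mktuple ffunE.
by have /forallP/(_ (Ordinal ltj))/eqP := xchooseP (ex (Ordinal lti) (Ordinal ltx)).
Qed.

(** * The semilattice equations in terms of entries *)

Definition entries_idem w : bool :=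
  [forall i, [forall x, [forall y,
    ~~ (has_entry i x y w && ~~ has_entry i y y w)]]].

(** Composites are unfolded into atoms by quantifying over the intermediate points: if y = x a_i, z
    = y a_i' and y' = x a_i', then y' a_i = z. Implications are negated conjunctions, to match the
    circuit combinators. *)
Definition entries_commute w : bool :=
  [forall i, [forall i', [forall x, [forall y, [forall y', [forall z,
    ~~ ((has_entry i x y w && has_entry i' y z w)
        && (has_entry i' x y' w && ~~ has_entry i y' z w))]]]]]].

Lemma entries_idemP a :
  reflect {in a, forall f : transf n, (f * f = f)%g} (entries_idem (code a)).
Proof.
apply: (iffP forallP) => [idem f /tnthP[i ->]|idem i].
  apply/ffunP=> x; rewrite ffunE.
  have /forallP/(_ x)/forallP/(_ (tnth a i x)) := idem i.
  by rewrite !has_entry_encode eqxx /= negbK => /eqP.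
apply/forallP=> x; apply/forallP=> y; rewrite !has_entry_encode.
apply/negP=> /andP[/eqP <-] /eqP; apply.
by have /ffunP/(_ x) := idem _ (mem_tnth i a); rewrite ffunE.
Qed.

Lemma entries_commuteP a :
  reflect {in a &, forall f g : transf n, (f * g = g * f)%g}
          (entries_commute (code a)).
Proof.
apply: (iffP forallP) => [comm f g /tnthP[i ->] /tnthP[i' ->]|comm i].
  apply/ffunP=> x; rewrite !ffunE.
  have /forallP/(_ i')/forallP/(_ x)/forallP/(_ (tnth a i x)) := comm i.
  move=> /forallP/(_ (tnth a i' x))/forallP/(_ (tnth a i' (tnth a i x))).
  by rewrite !has_entry_encode !eqxx /= negbK => /eqP.
apply/forallP=> i'; apply/forallP=> x; do 3! [apply/forallP=> ?].
rewrite !has_entry_encode.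
apply/negP=> /andP[/andP[/eqP <- /eqP <-] /andP[/eqP <-]] /eqP; apply.
by have /ffunP/(_ x) := comm _ _ (mem_tnth i a) (mem_tnth i' a); rewrite !ffunE.
Qed.

Definition encodes_semilattice w : bool :=
  [&& has_header w, has_entries w, entries_idem w & entries_commute w].

Lemma encodes_semilatticeP w : size w = (n + k).+2 + k * n * L ->
  encodes_semilattice w <->
  exists a, w = code a /\ is_semilattice (subsemigroup_gen [in a]).
Proof.
move=> sw; rewrite /encodes_semilattice andbA; split.
  move=> /andP[/(encodeP sw)[a ->] /andP[/entries_idemP ia /entries_commuteP ca]].
  by exists a; split=> //; apply/is_semilattice_genP.
move=> [a [wa /is_semilattice_genP[ia ca]]].
apply/andP; split; first by apply/(encodeP sw); exists a.
by rewrite wa; apply/andP; split; [apply/entries_idemP | apply/entries_commuteP].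
Qed.

End Encoding.

(** * Assembling the circuit family *)

Definition accepts_semilattice (m : nat) (w : seq bool) : bool :=
  [exists n : 'I_m.+1, [exists k : 'I_m.+1,
    [&& 0 < n, 0 < k & m == (n + k).+2 + k * n * bit_length n]
    && encodes_semilattice n k w]].

Lemma poly_realizes_accepts_semilattice :
  {d & {e & forall m, poly_realizes m d e (accepts_semilattice m)}}.
Proof.
(* Depth and exponent are left to unification. They are chosen before [m], as they depend only on
   the shape of the formula. *)
do 2 eexists; move=> m.
apply: poly_realizes_exists => [|n]; first by rewrite addn2.
apply: poly_realizes_exists => [|k]; first by rewrite addn2.
apply: poly_realizes_guard => /and3P[n_gt0 k_gt0 /eqP def_m].
(* The length equation bounds all quantifier ranges; for the digits this uses k n > 0. *)
have le_n : n <= m + 2 by lia.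
have le_k : k <= m + 2 by lia.
have le_h : (n + k).+2 <= m + 2 by lia.
have le_L : bit_length n <= m + 2.
  have : bit_length n <= k * n * bit_length n.
    by rewrite leq_pmull // muln_gt0 k_gt0.
  lia.
have rE (i : 'I_k) (x y : 'I_n) : poly_realizes m 2 2 (has_entry i x y).
  by apply: poly_realizes_forall => // j; apply: poly_realizes_literal.
have rNE (i : 'I_k) (x y : 'I_n) :
    poly_realizes m 3 4 (fun w => ~~ has_entry i x y w).
  exact: poly_realizes_not.
apply: poly_realizes_and.
  by apply: poly_realizes_forall => // p; apply: poly_realizes_literal.
apply: poly_realizes_and.
  apply: poly_realizes_forall => // i; apply: poly_realizes_forall => // x.
  by apply: poly_realizes_exists => // y.
apply: poly_realizes_and.
  do 3! [apply: poly_realizes_forall => // ?].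
  by apply/poly_realizes_not/poly_realizes_and.
do 6! [apply: poly_realizes_forall => // ?].
by apply/poly_realizes_not/poly_realizes_and; apply: poly_realizes_and.
Qed.

Lemma accepts_semilatticeP w :
  accepts_semilattice (size w) w <-> semilattice_problem w.
Proof.
split=> [/existsP[n /existsP[k /andP[/and3P[n_gt0 k_gt0 /eqP sw]]]]|].
  by move=> /(encodes_semilatticeP sw)[a [wa sa]]; exists n, k, a.
move=> [n [k [a [n_gt0 k_gt0 wa sa]]]].
have sw : size w = (n + k).+2 + k * n * bit_length n by rewrite wa size_encode.
have ltn_w : n < (size w).+1 by lia.
have ltk_w : k < (size w).+1 by lia.
apply/existsP; exists (Ordinal ltn_w); apply/existsP; exists (Ordinal ltk_w).
rewrite /= n_gt0 k_gt0 -sw eqxx /=.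
by apply/(encodes_semilatticeP sw); exists a.
Qed.

Theorem theorem3p3 : AC0 semilattice_problem.
Proof.
have [d [e rP]] := poly_realizes_accepts_semilattice.
exact: poly_realizes_AC0 rP accepts_semilatticeP.
Qed.
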